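(* Let $\{a_n\}_{n=0}^\infty$ be a sequence of nonnegative numbers. Then $$a_n^2\ge c_m\, a_{n-1}a_{n+1}\quad\text{for all } n\ge 1 \quad\Longrightarrow\quad \{a_n\}_{n=0}^\infty\in PF_m.$$
   Context: Here $c_m := 4\cos^2\frac{\pi}{m+1}$ for $m=2,3,4,\ldots$. $PF_m$ is the class of $m$-times positive sequences: the sequences $\{a_n\}_{n=0}^\infty$ such that all minors of order not greater than $m$ of the infinite upper triangular Toeplitz matrix $(a_{j-i})_{i,j\ge 0}$ (with $a_n=0$ for $n<0$) are non-negative.
   Formalization: The sequence is also assumed to have no internal zeros (if i<j<k and a_i, a_k are nonzero then a_j is nonzero); without this the claim fails, e.g. for 1,0,0,1,0,0,..., and every sequence in PF_m (m≥2) satisfies it. *)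

(* Defs.v *)
From HB Require Import structures.
From mathcomp Require Import all_boot all_order all_algebra.
From mathcomp Require Import all_classical all_reals all_analysis.

Set Implicit Arguments.
Unset Strict Implicit.
Unset Printing Implicit Defensive.

Import Order.TTheory GRing.Theory Num.Theory.
Local Open Scope ring_scope.

Definition cconst (R : realType) (m : nat) : R := 4 * cos (pi / m.+1%:R) ^+ 2.

(* The entry (i, j) of the infinite matrix (a_{j-i}), with a_n = 0 for n < 0;
   the test is needed because subtraction on nat is truncated. *)
Definition toeplitz (R : realType) (a : nat -> R) (i j : nat) : R :=
  if (i <= j)%N then a (j - i)%N else 0.

Definition minor (R : realType) (A : nat -> nat -> R) (k : nat)
    (r c : 'I_k -> nat) : R :=
  \det (\matrix_(p < k, q < k) A (r p) (c q)).

(* Order 0 is included harmlessly: the empty determinant is 1. *)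
Definition PF (R : realType) (m : nat) (a : nat -> R) : Prop :=
  forall (k : nat) (r c : 'I_k -> nat),
    (k <= m)%N ->
    {homo r : p q / (p < q)%N} ->
    {homo c : p q / (p < q)%N} ->
    0 <= minor (toeplitz a) r c.

(* The support is an interval. For m >= 2 this is implied by [PF m a], but not
   by a_n^2 >= c_m a_{n-1} a_{n+1}: take the sequence 1, 0, 0, 1, 0, 0, 0, ... *)
Definition no_internal_zeros (R : realType) (a : nat -> R) : Prop :=
  forall i j k : nat, (i < j)%N -> (j < k)%N ->
    a i != 0 -> a k != 0 -> a j != 0.

(* Main.v *)
Require Import Defs.
From HB Require Import structures.
From mathcomp Require Import all_boot all_order all_algebra.
From mathcomp Require Import all_classical all_reals all_analysis.
From mathcomp Require Import perm ring lra zify.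

Set Implicit Arguments.
Unset Strict Implicit.
Unset Printing Implicit Defensive.

Import Order.TTheory GRing.Theory Num.Theory.
Import numFieldNormedType.Exports.
Local Open Scope ring_scope.

(** Call a kernel A on nat * nat positive with ratio c if all its entries are
positive and c A(i,j+1) A(i+1,j) <= A(i,j) A(i+1,j+1).  The core of the proof
is that for c = 4 cos^2 (pi / (m+1)) every minor of order at most m of such a
kernel is nonnegative.

Write D_k(i,j) for the minor of order k on the consecutive rows from i and the
consecutive columns from j.  If A were tridiagonal, expansion along the first
row would give
  D_(k+2)(i,j) = A(i,j) D_(k+1)(i+1,j+1)
                 - A(i,j+1) A(i+1,j) D_k(i+2,j+2).
The key fact is that for every positive kernel with ratio c, as long as the
minors of lower order are positive, the right-hand side is still a lower bound.
It is obtained, together with the upper bound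
D_(k+1)(i,j) <= A(i,j) D_k(i+1,j+1), by an induction on the order that uses
only the Desnanot-Jacobi identity (desnanot_jacobi): two instances of it, for
consecutive orders, combine so that every term but the wanted ones cancels
(lower_step).  Inserting the ratio hypothesis in the lower bound, with c = t^2,
gives t s_(k+1) D_(k+1)(i,j) >= s_(k+2) A(i,j) D_k(i+1,j+1) for the solution of
s_(k+2) = t s_(k+1) - s_k with s_0 = 0 and s_1 = 1 (pivot_step).  For
t = 2 cos th this solution is sin (k th) / sin th, and th = pi / (m+1) makes it
positive for 0 < k <= m and zero at m+1; so D_k > 0 for k < m and D_m >= 0
(cminor_ge0).  Since c >= 1, the ratio hypothesis passes from neighbouring to
arbitrary pairs of rows and columns (ratio_all), so that a kernel restricted to
chosen rows and columns is again positive with ratio c, and all minors are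
reached (minor_ge0).

The Toeplitz matrix has zeros below its diagonal, and elsewhere if some terms of
the sequence vanish, so it is not a positive kernel.  A given minor
involves only the terms up to some index N; among these, the nonzero ones form
an interval [s, e], by the absence of internal zeros.  The zeros below s
are replaced by a_s x^(d^2) and those beyond e by a_e x^(d^2), where d is the
distance to [s, e] (fringe).  For small x > 0 this is a positive kernel with
ratio c (fringe_ratio), and the minor, a polynomial in x, has the required
value at x = 0. *)

(** * The Desnanot-Jacobi identity *)

Lemma det_block_schur (R : comUnitRingType) (n k : nat) (A : 'M[R]_n)
    (B : 'M[R]_(n, k)) (C : 'M[R]_(k, n)) (P : 'M[R]_k) :
  P \in unitmx ->
  \det (block_mx A B C P) = \det P * \det (A - B *m invmx P *m C).
Proof.
move=> uP.
have -> : block_mx A B C P =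
    block_mx (A - B *m invmx P *m C) B 0 P *m
    block_mx 1%:M 0 (invmx P *m C) 1%:M.
  rewrite mulmx_block !mulmx1 !mul0mx !mulmx0 !add0r mulmxA subrK.
  by rewrite mulmxA mulmxV // mul1mx.
by rewrite det_mulmx det_ublock det_lblock !det1 !mulr1 mulrC.
Qed.

Lemma det2 (R : comPzRingType) (S : 'M[R]_2) :
  \det S = S 0 0 * S 1 1 - S 0 1 * S 1 0.
Proof.
rewrite (expand_det_row _ 0) !big_ord_recl big_ord0 addr0 /cofactor !det_mx11.
rewrite !mxE /= !mulrA.
have -> : lift ord0 0 = 1 :> 'I_2 by apply: val_inj.
have -> : lift 1 0 = 0 :> 'I_2 by apply: val_inj.
by rewrite /bump /= addn0 expr0 expr1 mulr1 mulrN1 mulNr.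
Qed.

(** Each bordered minor [h x y] is det P times the entry (x, y) of the 2 x 2
Schur complement, and the whole determinant is det P times the determinant of
that complement. *)
Lemma sylvester2 (R : comUnitRingType) (k : nat) (A : 'M[R]_2)
    (B : 'M[R]_(2, k)) (C : 'M[R]_(k, 2)) (P : 'M[R]_k)
    (h : 'I_2 -> 'I_2 -> R) :
  P \in unitmx ->
  (forall x y, h x y =
     \det (block_mx (A x y)%:M (row x B) (col y C) P : 'M[R]_(1 + k))) ->
  \det (block_mx A B C P) * \det P = h 0 0 * h 1 1 - h 0 1 * h 1 0.
Proof.
move=> uP hB.
have hE x y : h x y = \det P * (A - B *m invmx P *m C) x y.
  rewrite hB det_block_schur // det_mx11 -row_mul colE mulmxA -row_mul -colE.
  by rewrite !mxE eqxx mulr1n.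
by rewrite det_block_schur // det2 !hE; ring.
Qed.

Definition cminor (R : comPzRingType) (A : nat -> nat -> R) (k i j : nat) : R :=
  \det (\matrix_(p < k, q < k) A (i + p)%N (j + q)%N).

Lemma val_ord_pred n (i : 'I_n.+1) :
  ord_pred i = (if i == 0 :> nat then n else i.-1) :> nat.
Proof.
case: i => [[|i] lti] /=; first by rewrite modn_small.
by rewrite modnDr modn_small // ltnW.
Qed.

(** The order k+2 matrix is brought to the form required by [sylvester2] by
moving its last row and its last column to the front.  The same cyclic
permutation acts on rows and columns, and in the product of the two off-corner
minors of order k+1 its sign occurs twice, so no sign has to be computed. *)
Lemma desnanot_jacobi (R : comUnitRingType) (A : nat -> nat -> R)
    (k i j : nat) :
  cminor A k i.+1 j.+1 \is a GRing.unit ->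
  cminor A k.+2 i j * cminor A k i.+1 j.+1 =
    cminor A k.+1 i j * cminor A k.+1 i.+1 j.+1 -
    cminor A k.+1 i j.+1 * cminor A k.+1 i.+1 j.
Proof.
set P := \matrix_(p < k, q < k) A (i.+1 + p)%N (j.+1 + q)%N.
rewrite {1}/cminor -/P => uP.
pose s n := perm (@ord_pred_inj n.+1).
pose M n x y := \matrix_(p < n.+1, q < n.+1) A (x + p)%N (y + q)%N.
(* The border rows, after the permutation: the last one, then the first one. *)
pose r (x : 'I_2) := if x == 0 then k.+1 else 0%N.
have sgn2 n (z : R) : (-1) ^+ s n * ((-1) ^+ s n * z) = z.
  by rewrite mulrA -signr_addb addbb mul1r.
have row_s n x y : \det (row_perm (s n) (M n x y)) =
    (-1) ^+ s n * \det (M n x y).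
  by rewrite row_permE det_mulmx det_perm.
have col_s n (N : 'M[R]_n.+1) : \det (col_perm (s n) N) = (-1) ^+ s n * \det N.
  by rewrite col_permE det_mulmx det_perm odd_permV mulrC.
pose Q : 'M[R]_2 := \matrix_(x, y) A (i + r x)%N (j + r y)%N.
pose B : 'M[R]_(2, k) := \matrix_(x, q) A (i + r x)%N (j + q.+1)%N.
pose C : 'M[R]_(k, 2) := \matrix_(p, y) A (i + p.+1)%N (j + r y)%N.
have ord_pred_border2 (p : 'I_(2 + k)) : ord_pred p =
    match fintype.split p with inl x => r x | inr p' => p'.+1 end :> nat.
  rewrite val_ord_pred; case: splitP => p' -> //.
  by case: p' => [[|[|//]] ?].
have ord_pred_border1 (x : 'I_2) (p : 'I_(1 + k)) :
    match fintype.split p with inl _ => r x | inr p' => p'.+1 end =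
    (if x == 0 then (ord_pred p).+1 else p) :> nat.
  rewrite val_ord_pred; case: splitP => p' ->; rewrite /r /= ?(ord1 p') //=.
  by case: eqP.
have NE : block_mx Q B C P = col_perm (s k.+1) (row_perm (s k.+1) (M k.+1 i j)).
  apply/matrixP => p q; rewrite !mxE !permE !ord_pred_border2.
  by case: splitP => p' _; rewrite !mxE; case: splitP => q' _;
    rewrite !mxE // !addSnnS.
pose f x (p : 'I_k.+1) : nat := if x == 0 :> 'I_2 then (ord_pred p).+1 else p.
have hE x y : \det (\matrix_(p, q) A (i + f x p)%N (j + f y q)%N) =
    \det (block_mx (Q x y)%:M (row x B) (col y C) P : 'M[R]_(1 + k)).
  congr (\det _); apply/matrixP => p q; rewrite !mxE /f -!ord_pred_border1.
  case: splitP => p' _; rewrite !mxE; case: splitP => q' _;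
    rewrite !mxE ?ord1 //.
  by rewrite !addSnnS.
have eqD := sylvester2 uP hE.
rewrite NE !col_s row_s sgn2 /f /= in eqD.
rewrite /cminor -!/(M _ _ _) -/P eqD mulrC; congr (_ * _ - _).
- have colrow (N : 'M[R]_k.+1) :
      \det N = \det (col_perm (s k) (row_perm (s k) N)).
    by rewrite col_s row_permE det_mulmx det_perm sgn2.
  rewrite [RHS]colrow.
  by congr (\det _); apply/matrixP => p q; rewrite !mxE !permE !addSnnS.
- have -> : \matrix_(p < k.+1, q < k.+1) A (i + (ord_pred p).+1)%N (j + q)%N =
      row_perm (s k) (M k i.+1 j).
    by apply/matrixP => p q; rewrite !mxE !permE !addSnnS.
  have -> : \matrix_(p < k.+1, q < k.+1) A (i + p)%N (j + (ord_pred q).+1)%N =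
      col_perm (s k) (M k i j.+1).
    by apply/matrixP => p q; rewrite !mxE !permE !addSnnS.
  by rewrite col_s row_s mulrACA -signr_addb addbb mul1r mulrC.
Qed.

(** * Consecutive minors of a positive kernel *)

Section Positive.
Variables (R : realFieldType) (m : nat) (t : R) (s : nat -> R).
Hypotheses (t_gt0 : 0 < t) (s0 : s 0%N = 0) (s1 : s 1%N = 1)
  (sS : forall k, s k.+2 = t * s k.+1 - s k)
  (s_gt0 : forall k, (0 < k <= m)%N -> 0 < s k).
Variable A : nat -> nat -> R.
Hypotheses (A_gt0 : forall i j, 0 < A i j)
  (A_ratio : forall i j,
     t ^+ 2 * (A i j.+1 * A i.+1 j) <= A i j * A i.+1 j.+1).

Let D := cminor A.

Let D0 i j : D 0 i j = 1.
Proof. exact: det_mx00. Qed.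

Let D1 i j : D 1 i j = A i j.
Proof. by rewrite /D /cminor det_mx11 mxE !addn0. Qed.

Let dodgson k i j : 0 < D k i.+1 j.+1 ->
  D k.+2 i j * D k i.+1 j.+1 =
    D k.+1 i j * D k.+1 i.+1 j.+1 - D k.+1 i j.+1 * D k.+1 i.+1 j.
Proof. by move=> Dgt0; apply: desnanot_jacobi; rewrite unitfE gt_eqF. Qed.

(** The product of the two off-corner minors in the Desnanot-Jacobi identity is
nonnegative and can be dropped. *)
Let upper_step k i j :
  0 < D k i.+1 j.+1 -> (forall i j, 0 <= D k.+1 i j) ->
  D k.+1 i j <= A i j * D k i.+1 j.+1 ->
  D k.+2 i j <= A i j * D k.+1 i.+1 j.+1.
Proof.
move=> P_gt0 D_ge0 U; rewrite -(ler_pM2r P_gt0) dodgson //.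
rewrite mulrAC (le_trans _ (ler_wpM2r (D_ge0 _ _) U)) //.
by rewrite gerBl mulr_ge0.
Qed.

(** Multiply the claim by the central minor X = D_(k+1)(i+1,j+1).  The identity
at order k+3 turns its right-hand side into a product minus the product of the
off-corner minors, which [U] bounds by A(i,j+1) A(i+1,j) times the product of
the off-corner minors of D_(k+2)(i+1,j+1).  The identity at order k+2 evaluates
the latter, and its correction term is exactly the one produced by [L]. *)
Let lower_step k i j :
  (forall i j, 0 < D k i j) -> (forall i j, 0 < D k.+1 i j) ->
  (forall i j, 0 < D k.+2 i j) ->
  (forall i j, D k.+2 i j <= A i j * D k.+1 i.+1 j.+1) ->
  A i j * D k.+1 i.+1 j.+1 - A i j.+1 * A i.+1 j * D k i.+2 j.+2 <=
    D k.+2 i j ->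
  A i j * D k.+2 i.+1 j.+1 - A i j.+1 * A i.+1 j * D k.+1 i.+2 j.+2 <=
    D k.+3 i j.
Proof.
move=> D_gt0 D1_gt0 D2_gt0 U L.
rewrite -(ler_pM2r (D1_gt0 i.+1 j.+1)) dodgson //.
have off : D k.+2 i j.+1 * D k.+2 i.+1 j <=
    (A i j.+1 * D k.+1 i.+1 j.+2) * (A i.+1 j * D k.+1 i.+2 j.+1).
  by apply: ler_pM => //; apply: ltW.
have E := congr1 ( *%R (A i j.+1 * A i.+1 j)) (dodgson (D_gt0 i.+2 j.+2)).
have LL := ler_wpM2r (ltW (D2_gt0 i.+1 j.+1)) L.
lra.
Qed.

(** This is the continued-fraction recursion f_(k+2) = 1 - 1 / (c f_(k+1)) for
lower bounds of the pivots D_(k+1)(i,j) / (A(i,j) D_k(i+1,j+1)), linearized by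
f_k = s_(k+1) / (t s_k). *)
Let pivot_step k i j :
  0 < s k.+1 -> 0 < s k.+2 ->
  s k.+2 * (A i.+1 j.+1 * D k i.+2 j.+2) <= t * s k.+1 * D k.+1 i.+1 j.+1 ->
  A i j * D k.+1 i.+1 j.+1 - A i j.+1 * A i.+1 j * D k i.+2 j.+2 <=
    D k.+2 i j ->
  0 < D k i.+2 j.+2 ->
  s k.+3 * (A i j * D k.+1 i.+1 j.+1) <= t * s k.+2 * D k.+2 i j.
Proof.
move=> s1_gt0 s2_gt0 P L D_gt0.
apply: le_trans (ler_wpM2l (mulr_ge0 (ltW t_gt0) (ltW s2_gt0)) L).
have r := ler_wpM2r (ltW D_gt0) (A_ratio i j).
have P' := ler_wpM2l (ltW (A_gt0 i j)) P.
have r' := ler_wpM2l (ltW s2_gt0) r.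
rewrite sS -(ler_pM2l t_gt0); lra.
Qed.

Let cminor_bounds k : (k.+2 <= m)%N -> forall i j,
  [/\ 0 < D k i j, 0 < D k.+1 i j,
      D k.+1 i j <= A i j * D k i.+1 j.+1,
      s k.+2 * (A i j * D k i.+1 j.+1) <= t * s k.+1 * D k.+1 i j &
      A i j * D k.+1 i.+1 j.+1 - A i j.+1 * A i.+1 j * D k i.+2 j.+2
        <= D k.+2 i j].
Proof.
elim: k => [|k IH] ltm i j.
  rewrite !D0 !D1 sS s0 s1; split; rewrite ?ltr01 ?A_gt0 //; try lra.
  have := dodgson (k := 0) (i := i) (j := j); rewrite !D0 !D1 mulr1.
  by move=> /(_ ltr01) ->; lra.
have {}IH := IH (ltnW ltm).
have D_gt0 i' j' : 0 < D k i' j' by case: (IH i' j').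
have D1_gt0 i' j' : 0 < D k.+1 i' j' by case: (IH i' j').
have s_pos l : (l < m)%N -> 0 < s l.+1 by move=> ?; rewrite s_gt0.
have P i' j' :
    s k.+3 * (A i' j' * D k.+1 i'.+1 j'.+1) <= t * s k.+2 * D k.+2 i' j'.
  case: (IH i'.+1 j'.+1) => _ _ _ P _; case: (IH i' j') => _ _ _ _ L.
  by apply: pivot_step => //; apply: s_pos; lia.
have D2_gt0 i' j' : 0 < D k.+2 i' j'.
  have c_gt0 : 0 < t * s k.+2 by rewrite mulr_gt0 // s_pos //; lia.
  rewrite -(pmulr_rgt0 _ c_gt0); apply: lt_le_trans (P i' j').
  by rewrite !mulr_gt0 // s_pos //; lia.
have U i' j' : D k.+2 i' j' <= A i' j' * D k.+1 i'.+1 j'.+1.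
  by apply: upper_step => // [x y|]; [exact: ltW | case: (IH i' j')].
by split => //; apply: lower_step => //; case: (IH i j).
Qed.

(** The last pivot estimate is used at k = m, where the factor [s m.+1] may
vanish; this is why the bounds above stop one order earlier. *)
Lemma cminor_ge0 k i j : (k <= m)%N -> 0 <= s m.+1 -> 0 <= cminor A k i j.
Proof.
move=> lekm sm_ge0; rewrite -/(D k i j).
have s_ge0 l : (l <= m.+1)%N -> 0 <= s l.
  case: l => [|l]; first by rewrite s0.
  by rewrite ltnS leq_eqVlt => /predU1P[->|?] //; rewrite ltW ?s_gt0.
case: k lekm => [|[|k]] lekm; first by rewrite D0.
  by rewrite D1 ltW.
have s2_gt0 : 0 < t * s k.+2 by rewrite mulr_gt0 ?s_gt0.
rewrite -(pmulr_rge0 _ s2_gt0).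
have D1_gt0 : 0 < D k.+1 i.+1 j.+1 by case: (cminor_bounds lekm i.+1 j.+1).
apply: le_trans (_ : s k.+3 * (A i j * D k.+1 i.+1 j.+1) <= _).
  by rewrite mulr_ge0 ?s_ge0 // mulr_ge0 // ltW.
case: (cminor_bounds lekm i.+1 j.+1) => _ _ _ P _.
case: (cminor_bounds lekm i j) => _ _ _ _ L.
apply: pivot_step => //; try (by apply: s_gt0; lia).
by case: (cminor_bounds lekm i.+2 j.+2).
Qed.
End Positive.

(** * Arbitrary minors of a positive kernel *)

Lemma ratio_all (R : realFieldType) (c : R) (u v : nat -> R) :
  1 <= c -> (forall j, 0 < u j) -> (forall j, 0 < v j) ->
  (forall j, c * (u j.+1 * v j) <= u j * v j.+1) ->
  forall j l, (j < l)%N -> c * (u l * v j) <= u j * v l.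
Proof.
move=> c_ge1 u_gt0 v_gt0 uv j l /subnK <-; elim: (l - j.+1)%N => [|d IH].
  exact: uv.
rewrite addSn; set n := (d + j.+1)%N in IH *.
have c_ge0 : 0 <= c by lra.
have x_gt0 : 0 < u n * v n by rewrite mulr_gt0.
rewrite -(ler_pM2r x_gt0).
apply: le_trans (_ : (c * (u n * v j)) * (c * (u n.+1 * v n)) <= _).
  have y_gt0 : 0 < c * (u n * v j) * (u n.+1 * v n).
    by rewrite !mulr_gt0 //; lra.
  rewrite [leRHS](_ : _ = c * (c * (u n * v j) * (u n.+1 * v n))); last by ring.
  rewrite [leLHS](_ : _ = c * (u n * v j) * (u n.+1 * v n)); last by ring.
  by rewrite ler_peMl // ltW.
have -> : u j * v n.+1 * (u n * v n) = (u j * v n) * (u n * v n.+1) by ring.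
by apply: ler_pM => //; rewrite !mulr_ge0 // ltW.
Qed.

(** Minors are taken on rows indexed by 'I_k, whereas consecutive minors need
kernels on all of nat. *)
Lemma ord_homo_extend (k : nat) (r : 'I_k -> nat) :
  {homo r : p q / (p < q)%N} ->
  exists2 r' : nat -> nat, {homo r' : p q / (p < q)%N} &
    forall p : 'I_k, r' p = r p.
Proof.
move=> r_homo; pose M := (\max_p r p).+1.
exists (fun n => if insub n is Some p then r p else (n + M)%N) => [p q ltpq|p].
  case: (insubP _ q) => [q' ltqk eq'|]; case: insubP => [p' ltpk ep'|].
  - by apply: r_homo; rewrite ep' eq'.
  - by rewrite (ltn_trans ltpq ltqk).
  - by move=> _; rewrite ltn_addl // ltnS leq_bigmax.
  - by rewrite ltn_add2r.
by case: insubP => [p' _ /val_inj -> //|]; rewrite ltn_ord.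
Qed.

(** The hypothesis 2 <= m puts s_3 = t^2 - 1 among the nonnegative terms of
[s], so that the ratio t^2 is at least 1, as [ratio_all] requires. *)
Lemma minor_ge0 (R : realFieldType) (m : nat) (t : R) (s : nat -> R) :
  (2 <= m)%N -> 0 < t -> s 0%N = 0 -> s 1%N = 1 ->
  (forall k, s k.+2 = t * s k.+1 - s k) ->
  (forall k, (0 < k <= m)%N -> 0 < s k) -> 0 <= s m.+1 ->
  forall A : nat -> nat -> R, (forall i j, 0 < A i j) ->
  (forall i j, t ^+ 2 * (A i j.+1 * A i.+1 j) <= A i j * A i.+1 j.+1) ->
  forall (k : nat) (r c : 'I_k -> nat), (k <= m)%N ->
  {homo r : p q / (p < q)%N} -> {homo c : p q / (p < q)%N} ->
  0 <= \det (\matrix_(p, q) A (r p) (c q)).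
Proof.
move=> m_ge2 t_gt0 s0 s1 sS s_gt0 sm_ge0 A A_gt0 A_ratio k r c lekm.
move=> /ord_homo_extend[r' r'_homo rE] /ord_homo_extend[c' c'_homo cE].
have t_ge1 : 1 <= t ^+ 2.
  have : 0 <= s 3%N.
    move: m_ge2; rewrite leq_eqVlt => /predU1P[->//|lt2m].
    by rewrite ltW // s_gt0.
  by rewrite !sS s1 s0; lra.
have -> : \matrix_(p, q) A (r p) (c q) =
    \matrix_(p < k, q < k) A (r' (0 + p)%N) (c' (0 + q)%N).
  by apply/matrixP => p q; rewrite !mxE !add0n rE cE.
apply: (cminor_ge0 t_gt0 s0 s1 sS s_gt0
  (A := fun p q => A (r' p) (c' q))) => //.
move=> i j.
have rows i' j1 j2 : (j1 < j2)%N ->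
    t ^+ 2 * (A i' j2 * A i'.+1 j1) <= A i' j1 * A i'.+1 j2.
  by move=> lt12; apply: (ratio_all (u := A i') (v := A i'.+1)) => //.
rewrite [X in _ * X]mulrC.
apply: (ratio_all (u := fun i => A i (c' j))
  (v := fun i => A i (c' j.+1))) => //.
  by move=> i'; rewrite [X in _ * X]mulrC; apply/rows/c'_homo.
exact: r'_homo.
Qed.

(** * Filling the zeros of a Toeplitz matrix *)

Section Fringe.
Variables (R : realFieldType) (a : nat -> R) (s e : nat).
Hypotheses (le_se : (s <= e)%N)
  (a_gt0 : forall n, (s <= n <= e)%N -> 0 < a n).

(** The Toeplitz kernel of a on [s, e], continued on both sides by Gaussian
tails in the variable 'X: beyond the support, consecutive ratios decrease by
the factor x^2, so for small x the tails satisfy any prescribed ratio condition,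
and at x = 0 they vanish. *)
Definition fringe (i j : nat) : {poly R} :=
  if (j < i + s)%N then a s *: 'X^((i + s - j) ^ 2)
  else if (j <= i + e)%N then (a (j - i)%N)%:P
  else a e *: 'X^((j - (i + e)) ^ 2).

(** The formulas for the tails also hold at the end points s and e, where the
exponent is 0.  This overlap reduces the cases of [fringe_ratio] to the position
of j - i alone. *)
Lemma fringe_left i j x : (j <= i + s)%N ->
  (fringe i j).[x] = a s * x ^+ ((i + s - j) ^ 2).
Proof.
rewrite /fringe leq_eqVlt => /predU1P[->|->]; last by rewrite !hornerE.
by rewrite ltnn leq_add2l le_se subnn addKn !hornerE.
Qed.

Lemma fringe_mid i j x : (i + s <= j <= i + e)%N ->
  (fringe i j).[x] = a (j - i)%N.
Proof. by rewrite /fringe ltnNge => /andP[-> ->] /=; rewrite hornerE. Qed.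

Lemma fringe_right i j x : (i + e <= j)%N ->
  (fringe i j).[x] = a e * x ^+ ((j - (i + e)) ^ 2).
Proof.
move=> le_ej; rewrite /fringe ltnNge (leq_trans _ le_ej) ?leq_add2l //=.
move: le_ej; rewrite leq_eqVlt => /predU1P[<-|lt_ej].
  by rewrite leqnn addKn subnn !hornerE.
by rewrite leqNgt lt_ej !hornerE.
Qed.

Lemma fringe_gt0 x i j : 0 < x -> 0 < (fringe i j).[x].
Proof.
move=> x_gt0; case: (leqP (i + s) j) => [le_sj|/ltnW lt_js].
  case: (leqP j (i + e)) => [le_je|/ltnW lt_ej].
    by rewrite fringe_mid ?le_sj //; apply: a_gt0; lia.
  by rewrite fringe_right // mulr_gt0 ?exprn_gt0 ?a_gt0 ?leqnn ?le_se.
by rewrite fringe_left // mulr_gt0 ?exprn_gt0 ?a_gt0 ?leqnn ?le_se.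
Qed.

Lemma gauss_ratio (c x z : R) d : 0 <= c -> 0 < x <= 1 -> c * x <= 1 ->
  c * ((z * x ^+ (d ^ 2)) * (z * x ^+ (d.+2 ^ 2))) <=
    (z * x ^+ (d.+1 ^ 2)) * (z * x ^+ (d.+1 ^ 2)).
Proof.
move=> c_ge0 /andP[x_gt0 x_le1] cx_le1; set w := z * x ^+ (d.+1 ^ 2).
have -> : z * x ^+ (d ^ 2) * (z * x ^+ (d.+2 ^ 2)) = x ^+ 2 * (w * w).
  have -> : z * x ^+ (d ^ 2) * (z * x ^+ (d.+2 ^ 2)) =
      z ^+ 2 * x ^+ (d ^ 2 + d.+2 ^ 2) by rewrite exprD; ring.
  have -> : x ^+ 2 * (w * w) = z ^+ 2 * x ^+ (2 + d.+1 ^ 2 + d.+1 ^ 2).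
    by rewrite /w !exprD; ring.
  by congr (_ * _ ^+ _); lia.
have ww_ge0 : 0 <= w * w by rewrite -expr2 sqr_ge0.
rewrite mulrA ler_piMl //.
by rewrite expr2 mulrA mulr_ile1 // ?mulr_ge0 // ltW.
Qed.

(** The hypothesis c x <= 1 takes care of the tails and of a support with a
single element; the last two hypotheses concern the end points of [s, e], where
one neighbour lies in a tail. *)
Lemma fringe_ratio (c x : R) i j :
  (forall n, (s < n < e)%N -> c * (a n.+1 * a n.-1) <= a n * a n) ->
  0 <= c -> 0 < x <= 1 -> c * x <= 1 ->
  c * x * a s.+1 <= a s -> c * x * a e.-1 <= a e ->
  c * ((fringe i j.+1).[x] * (fringe i.+1 j).[x]) <=
    (fringe i j).[x] * (fringe i.+1 j.+1).[x].
Proof.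
move=> a_ratio c_ge0 x01 cx_le1 cxs cxe.
have [as_gt0 ae_gt0] : 0 < a s /\ 0 < a e by split; apply: a_gt0; lia.
have -> : (fringe i.+1 j.+1).[x] = (fringe i j).[x].
  by rewrite /fringe !addSn !ltnS !subSS.
case: (ltnP j (i + s)) => [lt_js|le_sj].
  rewrite !fringe_left; try lia.
  have [d ed] : exists d, (i + s - j = d.+1)%N by exists (i + s - j).-1; lia.
  have -> : (i + s - j.+1 = d)%N by lia.
  have -> : (i.+1 + s - j = d.+2)%N by lia.
  by rewrite ed; apply: gauss_ratio.
case: (ltnP (i + e) j) => [lt_ej|le_je].
  rewrite !fringe_right; try lia.
  have [d ed] : exists d, (j - (i + e) = d.+1)%N
    by exists (j - (i + e)).-1; lia.
  have -> : (j.+1 - (i + e) = d.+2)%N by lia.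
  have -> : (j - (i.+1 + e) = d)%N by lia.
  by rewrite ed [_ * (a e * _)]mulrC; apply: gauss_ratio.
rewrite [(fringe i j).[x]]fringe_mid ?le_sj //.
have [x_gt0 x_le1] := andP x01.
case: (ltngtP (i + s) j) le_sj => // [lt_sj|eq_sj] _;
  case: (ltngtP j (i + e)) le_je => // [lt_je|eq_je] _.
- rewrite !fringe_mid; try lia.
  have -> : (j.+1 - i = (j - i).+1)%N by lia.
  have -> : (j - i.+1 = (j - i).-1)%N by lia.
  by apply: a_ratio; lia.
- rewrite fringe_right ?fringe_mid; try lia.
  have -> : (j - i.+1 = e.-1)%N by lia.
  have -> : (j.+1 - (i + e) = 1)%N by lia.
  have -> : (j - i = e)%N by lia.
  rewrite expr1.
  by have := ler_wpM2r (ltW ae_gt0) cxe; lra.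
- rewrite fringe_mid ?fringe_left; try lia.
  have -> : (j.+1 - i = s.+1)%N by lia.
  have -> : (i.+1 + s - j = 1)%N by lia.
  have -> : (j - i = s)%N by lia.
  rewrite expr1.
  by have := ler_wpM2r (ltW as_gt0) cxs; lra.
- rewrite fringe_right ?fringe_left; try lia.
  have -> : (i.+1 + s - j = 1)%N by lia.
  have -> : (j.+1 - (i + e) = 1)%N by lia.
  have -> : (j - i = s)%N by lia.
  have -> : e = s by lia.
  rewrite expr1 [leLHS](_ : _ = (c * x * x) * (a s * a s)); last by ring.
  rewrite ler_piMl ?mulr_ge0 ?(ltW as_gt0) //.
  by rewrite mulr_ile1 // ?mulr_ge0 // ltW.
Qed.

Lemma fringe0 i j : (i + s <= j <= i + e)%N = false -> (fringe i j).[0] = 0.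
Proof.
case: (leqP (i + s) j) => [le_sj /= /negbT|/[dup] lt_js /ltnW le_js _].
  rewrite -ltnNge => /[dup] lt_ej /ltnW le_ej.
  by rewrite fringe_right // expr0n expn_eq0 subn_eq0 leqNgt lt_ej mulr0.
by rewrite fringe_left // expr0n expn_eq0 subn_eq0 leqNgt lt_js mulr0.
Qed.

End Fringe.

(** * Passage to the limit *)

Section Limit.
Local Open Scope classical_set_scope.
Local Open Scope ring_scope.
Variable R : realType.

Lemma near0_mul_le (K z : R) : 0 < z -> \forall x \near 0^'+, K * x <= z.
Proof.
move=> z_gt0; have K_gt0 : 0 < `|K| + 1 by rewrite ltr_wpDl.
near=> x.
have x_gt0 : 0 < x by [].
have x_le : x <= z / (`|K| + 1).
  by near: x; apply: nbhs_right_le; rewrite divr_gt0.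
apply: le_trans (_ : (`|K| + 1) * x <= _); last by rewrite mulrC -ler_pdivlMr.
by rewrite ler_pM2r // (le_trans (ler_norm K)) // lerDl.
Unshelve. all: by end_near. Qed.

Lemma horner0_ge0 (p : {poly R}) :
  (\forall x \near 0^'+, 0 <= p.[x]) -> 0 <= p.[0].
Proof.
move=> p_ge0; have pc : horner p x @[x --> 0^'+] --> p.[0].
  by apply: cvg_at_right_filter; apply: continuous_horner.
by rewrite -(cvg_lim _ pc) //; apply: limr_ge => //; apply/cvg_ex; exists p.[0].
Qed.
End Limit.

(** * The constant 4 cos^2 (pi / (m+1)) *)

Lemma cconstE (R : realType) m : cconst R m = (2 * cos (pi / m.+1%:R)) ^+ 2.
Proof. by rewrite /cconst; ring. Qed.

Lemma sin_rec (R : realType) (th : R) (k : nat) :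
  sin (k.+2%:R * th) = 2 * cos th * sin (k.+1%:R * th) - sin (k%:R * th).
Proof.
have -> : k.+2%:R * th = k.+1%:R * th + th by rewrite -natr1; ring.
have -> : k%:R * th = k.+1%:R * th - th by rewrite -natr1; ring.
by rewrite sinD sinB; ring.
Qed.

(** [minor_ge0] for t = 2 cos (pi / (m+1)) and s_k = sin (k pi / (m+1)) /
sin (pi / (m+1)); here s_(m+1) = 0. *)
Lemma minor_trig_ge0 (R : realType) (m : nat) (A : nat -> nat -> R) :
  (2 <= m)%N -> (forall i j, 0 < A i j) ->
  (forall i j, cconst R m * (A i j.+1 * A i.+1 j) <= A i j * A i.+1 j.+1) ->
  forall (k : nat) (r c : 'I_k -> nat), (k <= m)%N ->
  {homo r : p q / (p < q)%N} -> {homo c : p q / (p < q)%N} ->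
  0 <= minor A r c.
Proof.
move=> m_ge2 A_gt0 A_ratio; pose th : R := pi / m.+1%:R.
have m1_gt0 : 0 < m.+1%:R :> R by rewrite ltr0n.
have sin_gt0 k : (0 < k <= m)%N -> 0 < sin (k%:R * th).
  move=> /andP[k_gt0 le_km]; apply: sin_gt0_pi; apply/andP; split.
    by rewrite mulr_gt0 ?ltr0n // divr_gt0 ?pi_gt0.
  by rewrite mulrCA gtr_pMr ?pi_gt0 // ltr_pdivrMr // mul1r ltr_nat.
have s1_gt0 : 0 < sin th by rewrite -[th]mul1r; apply: (sin_gt0 1%N); lia.
have sin_th_neq0 : sin th != 0 by rewrite gt_eqF.
apply: (minor_ge0 (t := 2 * cos th)
  (s := fun k => sin (k%:R * th) / sin th)) => //.
- have := sin_gt0 2%N m_ge2; rewrite sin_rec mul0r sin0 mul1r subr0.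
  by rewrite pmulr_lgt0.
- by rewrite mul0r sin0 mul0r.
- by rewrite mul1r divff.
- by move=> k; rewrite sin_rec /=; ring.
- by move=> k ?; rewrite divr_gt0 // sin_gt0.
- by rewrite mulrCA divff ?gt_eqF // mulr1 sinpi mul0r.
- by move=> i j; rewrite -cconstE.
Qed.

Theorem mainTheorem7 (R : realType) (m : nat) (hm : (2 <= m)%N)
    (a : nat -> R) (ha : forall n : nat, 0 <= a n)
    (hz : no_internal_zeros a) :
  (forall n : nat, (1 <= n)%N ->
     a n ^+ 2 >= cconst R m * a n.-1 * a n.+1) ->
  PF m a.
Proof.
move=> a_ratio k r c lekm r_homo c_homo.
pose N := \max_q c q.
have cN q : (c q <= N)%N by apply: leq_bigmax.
(* If all terms that may occur in the minor vanish, its matrix is zero. *)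
have [[n /andP[leN an]]|a0] :=
  pselect (exists n, (n <= N)%N && (a n != 0)); last first.
  suff -> : minor (toeplitz a) r c = \det (0 : 'M[R]_k).
    by case: (k) => [|l]; rewrite ?det_mx00 ?det0.
  congr (\det _); apply/matrixP => p q; rewrite !mxE /toeplitz.
  case: ifP => // _.
  apply/eqP/negPn/negP => apq; apply: a0; exists (c q - r p)%N.
  by rewrite apq andbT (leq_trans (leq_subr _ _)).
have exP : exists n, (n <= N)%N && (a n != 0) by exists n; rewrite leN.
have ubP i : (i <= N)%N && (a i != 0) -> (i <= N)%N by case/andP.
case: (ex_minnP exP) => s /andP[sN as_neq0] s_min.
case: (ex_maxnP exP ubP) => e /andP[eN ae_neq0] e_max.
have le_se : (s <= e)%N by apply: s_min; rewrite eN.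
have a_gt0 i : (s <= i <= e)%N -> 0 < a i.
  move=> /andP[le_si le_ie]; rewrite lt0r ha andbT.
  move: le_si le_ie; rewrite leq_eqVlt => /predU1P[<- //|lt_si].
  rewrite leq_eqVlt => /predU1P[-> //|lt_ie].
  exact: hz lt_si lt_ie as_neq0 ae_neq0.
have as_gt0 : 0 < a s by apply: a_gt0; rewrite leqnn.
have ae_gt0 : 0 < a e by apply: a_gt0; rewrite leqnn le_se.
pose F := fringe a s e.
pose p : {poly R} := \det (\matrix_(x < k, y < k) F (r x) (c y)).
have pE x : p.[x] = minor (fun i j => (F i j).[x]) r c.
  rewrite -[p.[x]]/(horner_eval x p) -det_map_mx; congr (\det _).
  by apply/matrixP => i j; rewrite !mxE.
have -> : minor (toeplitz a) r c = p.[0].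
  rewrite pE; congr (\det _); apply/matrixP => x y; rewrite !mxE /toeplitz.
  case: (boolP (r x + s <= c y <= r x + e)%N) => [mid|/negbTE out].
    by rewrite fringe_mid // ifT //; lia.
  rewrite fringe0 //; case: ifP => // le_xy.
  apply/eqP/negPn/negP => a_neq0.
  have in_supp : (c y - r x <= N)%N && (a (c y - r x)%N != 0).
    by rewrite a_neq0 (leq_trans (leq_subr _ _)).
  by have := s_min _ in_supp; have := e_max _ in_supp; lia.
have c_ge0 : 0 <= cconst R m by rewrite cconstE sqr_ge0.
(* These are the conditions of [fringe_ratio] at the two end points. *)
have small_s := near0_mul_le (cconst R m * a s.+1) as_gt0.
have small_e := near0_mul_le (cconst R m * a e.-1) ae_gt0.
apply: horner0_ge0; near=> x; rewrite pE.
have x_gt0 : 0 < x by [].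
apply: (minor_trig_ge0 hm) => // [i j|i j]; first exact: fringe_gt0.
apply: fringe_ratio => //.
- move=> l /andP[lt_sl lt_le]; rewrite -[leRHS]expr2 mulrA mulrAC.
  by apply: a_ratio; lia.
- by rewrite x_gt0 -[x]mul1r; near: x; apply: near0_mul_le.
- by near: x; apply: near0_mul_le.
- by rewrite mulrAC; near: x.
- by rewrite mulrAC; near: x.
Unshelve. all: by end_near. Qed.
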